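(* Let $\ell$ be an odd prime, let $\epsilon\in\mathbb{F}_\ell^\times$ be a non-square, and let $G=\mathrm{GL}_2(\mathbb{F}_\ell)$. For $s\in\{1,\ldots,\ell-1\}$ let $0\le\alpha_s,\beta_s\le\ell-1$ be the integers satisfying $\alpha_s\equiv 1\pmod{\ell}$ and $\beta_s\equiv s^{-1}\pmod{\ell}$. Then the $\mathbb{Q}$-linear map $$\psi : \mathbb{Q}\big[\mathbb{P}^1(\mathbb{F}_\ell)\times\mathbb{P}^1(\mathbb{F}_\ell)-\Delta\big]\longrightarrow\mathbb{Q}[\mathfrak{C}_\ell],\qquad (a,b)\longmapsto\sum_{s=1}^{\ell-1}(\alpha_s+\beta_s)\sum_{x\in\gamma^s_{(a,b)}}x$$ is a surjective $\mathbb{Q}[G]$-module homomorphism.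
   Context: $\mathbb{F}_\ell=\mathbb{Z}/\ell\mathbb{Z}$. For a set $S$, $\mathbb{Q}[S]$ is the free $\mathbb{Q}$-vector space on $S$; if $G$ acts on $S$ then $\mathbb{Q}[S]$ is a $\mathbb{Q}[G]$-module by linear extension. $\mathbb{P}^1(\mathbb{F}_\ell)\times\mathbb{P}^1(\mathbb{F}_\ell)-\Delta$ is the set of ordered pairs $(a,b)$ of distinct points of $\mathbb{P}^1(\mathbb{F}_\ell)$. $\mathfrak{C}_\ell=\{x+y\sqrt{\epsilon}: x\in\mathbb{F}_\ell,\ y\in\mathbb{F}_\ell^\times\}\subseteq\mathbb{F}_{\ell^2}$. $G$ acts on $\mathbb{P}^1(\mathbb{F}_\ell)$ and on $\mathfrak{C}_\ell$ by fractional linear transformations $z\mapsto (pz+q)/(rz+u)$ for the matrix $\begin{pmatrix}p&q\\ r&u\end{pmatrix}$, and on pairs of points componentwise. For $s\in\mathbb{F}_\ell^\times$ (identified with $\{1,\dots,\ell-1\}$) the path $\gamma^s_{(a,b)}\subseteq\mathfrak{C}_\ell$ from $a$ to $b$ is defined as follows. $\gamma^s_{(0,\infty)}=\{\lambda s+\lambda\sqrt{\epsilon}:\lambda\in\mathbb{F}_\ell^\times\}$. For a general ordered pair $(a,b)$ choose $g\in G$ with $g(0)=a$, $g(\infty)=b$ and set $\gamma^s_{(a,b)}:=g(\gamma^s_{(0,\infty)})$; this does not depend on the choice of $g$. *)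

(* Defs.v *)
From mathcomp Require Import all_boot all_order all_fingroup all_algebra.
From mathcomp Require Import ring.

Set Implicit Arguments.
Unset Strict Implicit.
Unset Printing Implicit Defensive.

Import GRing.Theory.
Local Open Scope ring_scope.

(* As S is finite, Q[S] is the space of all functions S -> Q; the codomain is
   rat^o so that {ffun S -> rat^o} inherits the structure of a Q-module. *)
Definition qfree (S : finType) := {ffun S -> rat^o}.

Definition qpt (S : finType) (x : S) : qfree S := [ffun y => (y == x)%:R].

(* The Q-linear extension to Q[S] of a map f defined on the basis S. *)
Definition qext (S : finType) (V : lmodType rat) (f : S -> V) (v : qfree S) : V :=
  \sum_(x : S) v x *: f x.

Lemma qext_pt (S : finType) (V : lmodType rat) (f : S -> V) (x : S) :
  qext f (qpt x) = f x.
Proof.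
rewrite /qext (bigD1 x) //= big1 => [|y yx]; rewrite ffunE.
  by rewrite eqxx scale1r addr0.
by rewrite (negPf yx) scale0r.
Qed.

Definition is_laction (gT : finGroupType) (S : Type) (a : gT -> S -> S) : Prop :=
  (forall x, a 1%g x = x) /\ (forall g h x, a (g * h)%g x = a g (a h x)).

(* The scalar multiplication Q[G] x Q[S] -> Q[S] extending an action a of G on
   S bilinearly. *)
Definition qGscale (gT : finGroupType) (S : finType) (a : gT -> S -> S)
    (r : qfree gT) (v : qfree S) : qfree S :=
  qext (fun g => qext (fun x => qpt (a g x)) v) r.

Definition qG_hom (gT : finGroupType) (S T : finType)
    (aS : gT -> S -> S) (aT : gT -> T -> T) (f : qfree S -> qfree T) : Prop :=
  linear f /\
  forall (r : qfree gT) (v : qfree S), f (qGscale aS r v) = qGscale aT r (f v).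

(* The value (p z + q) / (r z + u), meaningful when r z + u != 0. *)
Definition flt (K : fieldType) (M : 'M[K]_2) (z : K) : K :=
  (M 0 0 * z + M 0 1) / (M 1 0 * z + M 1 1).

(* P^1(K) = K + {oo}, where None stands for oo. *)
Definition P1 (K : Type) := option K.

Definition P1act (F : finFieldType) (g : {'GL_2[F]}) (z : P1 F) : P1 F :=
  match z with
  | Some z =>
      if GLval g 1 0 * z + GLval g 1 1 == 0 then None
      else Some (flt g z)
  | None =>
      if GLval g 1 0 == 0 then None
      else Some (GLval g 0 0 / GLval g 1 0)
  end.

Lemma sum2E (R : nmodType) (f : 'I_2 -> R) : \sum_(i < 2) f i = f 0 + f 1.
Proof.
by rewrite big_ord_recl big_ord_recl big_ord0 addr0; congr (_ + f _); apply: val_inj.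
Qed.

Lemma GL2_det (F : finFieldType) (g : {'GL_2[F]}) :
  GLval g 0 0 * GLval g 1 1 - GLval g 0 1 * GLval g 1 0 != 0.
Proof.
have := GL_unit g; rewrite -[_ \is a _]/(GLval g \in unitmx) unitmxE unitfE.
apply: contra => /eqP E; rewrite (expand_det_row _ 0) sum2E /cofactor !det_mx11 !mxE.
have -> : lift 0 0 = 1 :> 'I_2 by apply: val_inj.
have -> : lift 1 0 = 0 :> 'I_2 by apply: val_inj.
by rewrite /= expr0 expr1 mul1r mulN1r mulrN E.
Qed.

Lemma P1act_laction (F : finFieldType) : is_laction (@P1act F).
Proof.
split=> [[z|]|g h z].
- by rewrite /P1act /flt GL_1E !mxE /= mul0r add0r oner_eq0 mul1r addr0 divr1.
- by rewrite /P1act GL_1E !mxE /= eqxx.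
have := GL2_det g; have := GL2_det h.
have Egh i j : GLval (g * h)%g i j =
    GLval g i 0 * GLval h 0 j + GLval g i 1 * GLval h 1 j.
  by rewrite GL_MxE mxE sum2E.
rewrite /P1act /flt !Egh.
move: (GLval g 0 0) (GLval g 0 1) (GLval g 1 0)
      (GLval g 1 1) => a b c d.
move: (GLval h 0 0) (GLval h 0 1) (GLval h 1 0)
      (GLval h 1 1) => p q r u hD gD {Egh}.
case: z => [z|].
- have [D0|D0] := eqVneq (r * z + u) 0.
    have N0 : p * z + q != 0.
      apply: contraNneq hD => N0.
      have -> : u = - (r * z) by apply/eqP; rewrite -addr_eq0 addrC D0.
      have -> : q = - (p * z) by apply/eqP; rewrite -addr_eq0 addrC N0.
      by apply/eqP; ring.
    have -> : (c * p + d * r) * z + (c * q + d * u) =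
              c * (p * z + q) + d * (r * z + u) by ring.
    have -> : (a * p + b * r) * z + (a * q + b * u) =
              a * (p * z + q) + b * (r * z + u) by ring.
    rewrite D0 !mulr0 !addr0 mulf_eq0 (negPf N0) orbF.
    by case: eqVneq => // c0; congr Some; field; rewrite c0 N0.
  have -> : (c * p + d * r) * z + (c * q + d * u) =
            (c * ((p * z + q) / (r * z + u)) + d) * (r * z + u) by field.
  have -> : (a * p + b * r) * z + (a * q + b * u) =
            (a * ((p * z + q) / (r * z + u)) + b) * (r * z + u) by field.
  rewrite mulf_eq0 (negPf D0) orbF; case: eqVneq => // E0.
  by congr Some; rewrite -mulf_div divff // mulr1.
have [r0|r0] := eqVneq r 0.
  have p0 : p != 0.
    by apply: contraNneq hD => ->; rewrite r0 mulr0 mul0r subr0.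
  rewrite r0 !mulr0 !addr0 mulf_eq0 (negPf p0) orbF.
  by case: eqVneq => // c0; congr Some; field; rewrite c0 p0.
have -> : c * p + d * r = (c * (p / r) + d) * r by field.
have -> : a * p + b * r = (a * (p / r) + b) * r by field.
rewrite mulf_eq0 (negPf r0) orbF; case: eqVneq => // E0.
by congr Some; rewrite -mulf_div divff // mulr1.
Qed.

Lemma P1act_inj (F : finFieldType) (g : {'GL_2[F]}) : injective (@P1act F g).
Proof.
have [a1 aM] := P1act_laction F.
by apply: (can_inj (g := @P1act F g^-1%g)) => z; rewrite -aM mulVg a1.
Qed.

Definition P1pair (F : finFieldType) := {ab : P1 F * P1 F | ab.1 != ab.2}.

Lemma P1pair_stable (F : finFieldType) (g : {'GL_2[F]}) (ab : P1pair F) :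
  P1act g (val ab).1 != P1act g (val ab).2.
Proof. by rewrite (inj_eq (@P1act_inj _ g)) (valP ab). Qed.

Definition P1pair_act (F : finFieldType) (g : {'GL_2[F]}) (ab : P1pair F) :
    P1pair F :=
  exist _ (P1act g (val ab).1, P1act g (val ab).2) (P1pair_stable g ab).

Lemma P1pair_act_laction (F : finFieldType) : is_laction (@P1pair_act F).
Proof.
have [a1 aM] := P1act_laction F.
split=> [ab|g h ab]; apply: val_inj; rewrite /= ?a1 ?aM //.
by case: (val ab).
Qed.

(* Below F is embedded in L by iota, and w is a square root in L of the image
   of a non-square element of F. *)
Definition Cset (F L : finFieldType) (iota : {rmorphism F -> L}) (w : L) : {set L} :=
  [set iota xy.1 + iota xy.2 * w | xy : F * F & xy.2 != 0].

Definition Cl (F L : finFieldType) (iota : {rmorphism F -> L}) (w : L) :=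
  {z : L | z \in Cset iota w}.

(* insubd is used to avoid carrying the hypotheses on w; the lemma val_Cact
   below shows that its default value is never taken. *)
Definition Cact (F L : finFieldType) (iota : {rmorphism F -> L}) (w : L)
    (g : {'GL_2[F]}) (z : Cl iota w) : Cl iota w :=
  insubd z (flt (map_mx iota g) (val z)).

Lemma norm_neq0 (F : fieldType) (eps x y : F) :
  (forall t, t ^+ 2 != eps) -> y != 0 -> x ^+ 2 - eps * y ^+ 2 != 0.
Proof.
move=> nsq y0; apply: contraNneq (nsq (x / y)) => /eqP.
by rewrite subr_eq0 => /eqP E; rewrite expr_div_n E mulfK // expf_neq0.
Qed.

Lemma norm_den_neq0 (F : fieldType) (eps c d x y : F) :
  (forall t, t ^+ 2 != eps) -> y != 0 -> (c != 0) || (d != 0) ->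
  (c * x + d) ^+ 2 - eps * (c * y) ^+ 2 != 0.
Proof.
move=> nsq y0 cd.
have [c0|c0] := eqVneq c 0.
  move: cd; rewrite c0 eqxx /= !mul0r add0r (expr2 0) !mulr0 subr0.
  by apply: expf_neq0.
by apply: norm_neq0 => //; rewrite mulf_neq0.
Qed.

Lemma Cl_den_neq0 (F L : finFieldType) (iota : {rmorphism F -> L}) (eps : F) (w : L)
    (c d x y : F) :
  (forall t, t ^+ 2 != eps) -> w ^+ 2 = iota eps -> y != 0 ->
  (c != 0) || (d != 0) ->
  iota c * (iota x + iota y * w) + iota d != 0.
Proof.
move=> nsq wE y0 cd.
have: (c * x + d) ^+ 2 - eps * (c * y) ^+ 2 != 0 by exact: norm_den_neq0.
rewrite -(fmorph_eq0 iota); apply: contraNneq => E.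
apply/eqP; transitivity ((iota c * (iota x + iota y * w) + iota d) *
              (iota c * (iota x - iota y * w) + iota d)); last by rewrite E mul0r.
by rewrite !(rmorphB, rmorphD, rmorphM) /= -wE; ring.
Qed.

Lemma GL2_row1 (F : finFieldType) (g : {'GL_2[F]}) :
  (GLval g 1 0 != 0) || (GLval g 1 1 != 0).
Proof.
rewrite -negb_and; apply: contra (GL2_det g) => /andP[/eqP-> /eqP->].
by rewrite !mulr0 subrr.
Qed.

Lemma val_Cact (F L : finFieldType) (iota : {rmorphism F -> L}) (eps : F) (w : L)
    (g : {'GL_2[F]}) (z : Cl iota w) :
  (forall t, t ^+ 2 != eps) -> w ^+ 2 = iota eps ->
  val (Cact g z) = flt (map_mx iota g) (val z).
Proof.
move=> nsq wE; rewrite /Cact val_insubd.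
suff -> : flt (map_mx iota g) (val z) \in Cset iota w by [].
case: z => z /= /imsetP[[x y]]; rewrite inE /= => y0 ->.
have D0 := Cl_den_neq0 x nsq wE y0 (GL2_row1 g).
have := GL2_det g; have := GL2_row1 g; rewrite /flt !mxE; move: D0.
move: (GLval g 0 0) (GLval g 0 1) (GLval g 1 0)
      (GLval g 1 1) => a b c d D0 cd gD.
have N0 : (c * x + d) ^+ 2 - eps * (c * y) ^+ 2 != 0 by exact: norm_den_neq0.
pose N := (c * x + d) ^+ 2 - eps * (c * y) ^+ 2.
apply/imsetP; exists (((a * x + b) * (c * x + d) - eps * (a * y) * (c * y)) / N,
                      ((a * d - b * c) * y) / N).
  by rewrite inE /= !mulf_neq0 // invr_eq0.
rewrite /= !fmorph_div /=; have: iota N != 0 by rewrite fmorph_eq0.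
rewrite /N !(rmorphB, rmorphM, rmorphD) /= -wE => iN0.
by field; rewrite D0 iN0.
Qed.

Lemma Cact_laction (F L : finFieldType) (iota : {rmorphism F -> L}) (eps : F) (w : L) :
  (forall t, t ^+ 2 != eps) -> w ^+ 2 = iota eps -> is_laction (@Cact F L iota w).
Proof.
move=> nsq wE; split=> [z|g h z]; apply: val_inj; rewrite !(val_Cact _ _ nsq wE).
  rewrite /flt !mxE /= rmorph0 rmorph1.
  by rewrite mul1r addr0 mul0r add0r divr1.
have hz := val_Cact h z nsq wE; have := valP (Cact h z); rewrite hz.
case/imsetP=> [[x' y']]; rewrite inE /= => y0' E'.
have gD := Cl_den_neq0 x' nsq wE y0' (GL2_row1 g); rewrite -{}E' in gD.
case/imsetP: (valP z) => [[x y]]; rewrite inE /= => y0 E.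
have hD := Cl_den_neq0 x nsq wE y0 (GL2_row1 h); rewrite -{}E in hD.
move: gD hD; rewrite /flt !mxE !sum2E.
rewrite !(rmorphD, rmorphM) /=.
move: (iota _) (iota _) (iota _) (iota _) => r q p c.
move: (iota _) (iota _) (iota _) (iota _) (val z) => b a d u t gD hD.
have -> : (c * p + d * r) * t + (c * q + d * u) =
          (c * ((p * t + q) / (r * t + u)) + d) * (r * t + u) by field.
have -> : (a * p + b * r) * t + (a * q + b * u) =
          (a * ((p * t + q) / (r * t + u)) + b) * (r * t + u) by field.
by rewrite -mulf_div divff // mulr1.
Qed.

Definition gamma0oo (F L : finFieldType) (iota : {rmorphism F -> L}) (w : L) (s : F) :
    {set Cl iota w} :=
  [set z : Cl iota w |
    [exists lam : F, (lam != 0) && (val z == iota (lam * s) + iota lam * w)]].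

(* [pick] chooses g with g(0) = a and g(oo) = b; the lemmas gamma_exists and
   gammaE below show that such a g exists and that its choice is irrelevant. *)
Definition gamma (F L : finFieldType) (iota : {rmorphism F -> L}) (w : L) (s : F)
    (ab : P1pair F) : {set Cl iota w} :=
  if [pick g : {'GL_2[F]} |
       (P1act g (Some 0) == (val ab).1) && (P1act g None == (val ab).2)] is Some g
  then [set Cact g z | z in gamma0oo iota w s] else set0.

Lemma gamma_exists (F : finFieldType) (ab : P1pair F) :
  exists g : {'GL_2[F]}, P1act g (Some 0) = (val ab).1 /\ P1act g None = (val ab).2.
Proof.
have mk (p q r u : F) : p * u - q * r != 0 ->
    exists g : {'GL_2[F]}, [/\ GLval g 0 0 = p, GLval g 0 1 = q,
      GLval g 1 0 = r & GLval g 1 1 = u].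
  move=> D0.
  pose M : 'M[F]_2 := \matrix_(i, j)
    if i == 0 then (if j == 0 then p else q) else (if j == 0 then r else u).
  have MU : M \is a GRing.unit.
    rewrite -[_ \is a _]/(M \in unitmx) unitmxE unitfE.
    rewrite (expand_det_row _ 0) sum2E /cofactor !det_mx11 !mxE /=.
    by rewrite expr0 expr1 mul1r mulN1r mulrN.
  by exists (Sub M MU : {'GL_2[F]}); rewrite [GLval _]SubK !mxE.
case: ab => [[[a|] [b|]]] //= ne.
- have ab : b - a != 0 by rewrite subr_eq0; apply: contraNneq ne => ->.
  have /mk[g [g00 g01 g10 g11]] : b * 1 - a * 1 != 0 by rewrite !mulr1.
  exists g; rewrite /P1act /flt g00 g01 g10 g11 !mulr0 !add0r oner_eq0.
  by rewrite !divr1.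
- have /mk[g [g00 g01 g10 g11]] : 1 * 1 - a * 0 != 0 :> F.
    by rewrite mulr0 subr0 mulr1 oner_eq0.
  exists g; rewrite /P1act /flt g00 g01 g10 g11 !mulr0 !add0r oner_eq0 eqxx.
  by rewrite !divr1.
- have /mk[g [g00 g01 g10 g11]] : b * 0 - 1 * 1 != 0 :> F.
    by rewrite mulr0 sub0r oppr_eq0 mulr1 oner_eq0.
  exists g; rewrite /P1act /flt g00 g01 g10 g11 !mulr0 !add0r oner_eq0 eqxx.
  by rewrite !divr1.
Qed.

Lemma gammaE (F L : finFieldType) (iota : {rmorphism F -> L}) (eps : F) (w : L) (s : F)
    (ab : P1pair F) (g : {'GL_2[F]}) :
  (forall t, t ^+ 2 != eps) -> w ^+ 2 = iota eps ->
  P1act g (Some 0) = (val ab).1 -> P1act g None = (val ab).2 ->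
  gamma iota w s ab = [set Cact g z | z in gamma0oo iota w s].
Proof.
move=> nsq wE g0 goo; rewrite /gamma; case: pickP => [h /andP[/eqP h0 /eqP hoo]|]; last first.
  by move/(_ g); rewrite g0 goo !eqxx.
have [P1a PaM] := P1act_laction F; have [C1 CM] := Cact_laction nsq wE.
have stab (k : {'GL_2[F]}) : P1act k (Some 0) = Some 0 -> P1act k None = None ->
    forall z, z \in gamma0oo iota w s -> Cact k z \in gamma0oo iota w s.
  rewrite /P1act /flt !mulr0 !add0r => k0 koo z.
  have := GL2_det k; have kz := val_Cact k z nsq wE.
  move: k0 koo; case: eqVneq => // d0 [] /eqP.
  rewrite mulf_eq0 invr_eq0 (negPf d0) orbF => /eqP b0.
  case: eqVneq => // c0 _; rewrite b0 c0 mulr0 subr0 mulf_eq0 (negPf d0) orbF => a0.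
  rewrite !inE => /existsP[lam /andP[lam0 /eqP zE]]; apply/existsP.
  exists (GLval k 0 0 / GLval k 1 1 * lam).
  rewrite !mulf_neq0 ?invr_eq0 //= kz /flt !mxE b0 c0 zE.
  rewrite !(rmorph0, rmorphM, fmorphV) /= mul0r add0r addr0; apply/eqP; field.
  by rewrite fmorph_eq0.
have sub (h1 h2 : {'GL_2[F]}) : P1act h1 (Some 0) = P1act h2 (Some 0) ->
    P1act h1 None = P1act h2 None ->
    [set Cact h1 z | z in gamma0oo iota w s] \subset
    [set Cact h2 z | z in gamma0oo iota w s].
  move=> e0 eoo; apply/subsetP => _ /imsetP[z zP ->]; apply/imsetP.
  exists (Cact (h2^-1 * h1)%g z); last by rewrite -CM mulgA mulgV mul1g.
  by apply: stab => //; rewrite PaM (e0, eoo) -PaM mulVg P1a.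
by apply/eqP; rewrite eqEsubset !sub // ?g0 ?goo.
Qed.

(* The linear map attached to weights c_s, 1 <= s <= l - 1; the integer s
   stands for its class s%:R in F_l. *)
Definition psi (l : nat) (L : finFieldType) (iota : {rmorphism 'F_l -> L}) (w : L)
    (c : nat -> rat) : qfree (P1pair 'F_l) -> qfree (Cl iota w) :=
  qext (fun ab =>
    \sum_(1 <= s < l) c s *: \sum_(x in gamma iota w s%:R ab) qpt x).

(* Main.v *)
From HB Require Import structures.
Require Import Defs.
From mathcomp Require Import all_boot all_order all_fingroup all_algebra.
From mathcomp Require Import finfield ring zify.

Import GRing.Theory.
Local Open Scope ring_scope.

(** Write F for the field with l elements.  That psi commutes with G comes from
the identity gamma^s(g ab) = g gamma^s(ab) ([gamma_act]).

Surjectivity is proved modulo l.  The matrix of psi has natural number entries,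
and a minor which is nonzero modulo l is nonzero, so it is enough that the
columns of this matrix are linearly independent over F ([qext_surj_modp]).
Modulo l the weight alpha_s + beta_s becomes 1 + 1/s, and by G-equivariance a
relation between the columns is a function f on the upper half plane, with
values in F, such that for every g in G
    sum_(s <> 0) (1 + 1/s) sum_(lam <> 0) f(g (lam (s + w))) = 0.      (R)
These functions form a G-module K, to be shown zero.

The translations z -> z + t form an l-group, so a nonzero K would contain a
nonzero function which they fix, that is, a function of Im z = y alone; the
homotheties z -> m z would then single out in K a power y^-k of the imaginary
part.  The proof makes this explicit with the moments sum x^j y^k f(x + y w).
If j is minimal such that some moment of order j is nonzero, the sum of
m^k t^j f(m z + t) over m and t is y^-k times the moment of order (j, k)
([moment_translates]), and it lies in K.

It remains to see that no y^-k is in K ([im_sum_neq0]).  If l - 1 divides k,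
relation (R) with g = 1 would say (-1)(-1) = 0.  Otherwise take 0 < k < l - 1
and g(z) = z / (1 - z).  With t = 1/lam the sum in (R) becomes
    sum_(s <> 0) (1 + 1/s) sum_t t^e ((t - s)^2 - eps)^k,   e = l - 1 - k,
and since a polynomial of degree less than 2 (l - 1) has minus its coefficient
of degree l - 1 as the sum of its values ([sum_horner]), this is c_k + e c_(k+1)
where c_i is the coefficient of X^i in (X^2 - eps)^k ([orbit_sum_neq0]).  The
weight 1 is responsible for the first term and 1/s for the second.  Exactly one
of c_k and c_(k+1) is nonzero, according to the parity of k: this is why the sum
of an even and of an odd weight is needed. *)

Set Implicit Arguments.
Unset Strict Implicit.

(** * Linear algebra: surjectivity from injectivity of the transpose modulo l *)

Lemma row_full_ker (K : fieldType) (m n : nat) (B : 'M[K]_(m, n)) :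
  (forall c : 'cV_n, B *m c = 0 -> c = 0) -> row_full B.
Proof.
move=> inj; rewrite /row_full -mxrank_tr -/(row_free _) -kermx_eq0.
apply/eqP/row_matrixP => i; rewrite row0.
apply: trmx_inj; rewrite trmx0; apply: inj.
by rewrite -{1}[B]trmxK -trmx_mul -row_mul mulmx_ker row0 trmx0.
Qed.

(** Full rank over K is witnessed by a maximal minor, an integer whose image in
K is nonzero; this integer is then nonzero itself. *)
Lemma row_full_intr (K : fieldType) (m n : nat) (A : 'M[int]_(m, n)) :
  row_full (map_mx intr A : 'M[K]_(m, n)) ->
  row_full (map_mx intr A : 'M[rat]_(m, n)).
Proof.
move=> fullA.
have := fullrowsub_unit fullA; set f := fullrankfun fullA.
have subE (R : fieldType) : rowsub f (map_mx intr A : 'M[R]_(m, n)) =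
    map_mx intr (rowsub f A) by apply/matrixP=> i j; rewrite !mxE.
rewrite unitmxE unitfE subE det_map_mx => detK.
have : rowsub f (map_mx intr A : 'M[rat]_(m, n)) \in unitmx.
  rewrite unitmxE unitfE subE det_map_mx intr_eq0.
  by apply: contraNneq detK => ->; rewrite rmorph0.
move=> U; rewrite -sub1mx -(mulVmx U) mulmx_sub //.
by apply/row_subP=> i; rewrite row_rowsub row_sub.
Qed.

Lemma qext_is_linear (S : finType) (V : lmodType rat) (f : S -> V) :
  linear (qext f).
Proof.
move=> a u v; rewrite /qext scaler_sumr -big_split; apply: eq_bigr => x _.
by rewrite !ffunE scalerDl scalerA.
Qed.

HB.instance Definition _ (S : finType) (V : lmodType rat) (f : S -> V) :=
  GRing.isLinear.Build rat (qfree S) V _ (qext f) (@qext_is_linear S V f).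

Lemma linear_qext (S : finType) (V W : lmodType rat) (h : {linear V -> W})
    (f : S -> V) (v : qfree S) : h (qext f v) = qext (fun x => h (f x)) v.
Proof. by rewrite /qext linear_sum; apply: eq_bigr => x _; rewrite linearZ. Qed.

Lemma eq_qext (S : finType) (V : lmodType rat) (f g : S -> V) (v : qfree S) :
  f =1 g -> qext f v = qext g v.
Proof. by move=> fg; apply: eq_bigr => x _; rewrite fg. Qed.

Lemma qfree_sum_pt (S : finType) (v : qfree S) : v = \sum_x v x *: qpt x.
Proof.
apply/ffunP => y; rewrite sum_ffunE (bigD1 y) //= big1 => [|x xy].
  by rewrite !ffunE eqxx addr0 /GRing.scale /= mulr1.
by rewrite !ffunE eq_sym (negPf xy) scaler0.
Qed.

Lemma qext_hom (gT : finGroupType) (S T : finType)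
    (aS : gT -> S -> S) (aT : gT -> T -> T) (f : S -> qfree T) :
  (forall g x, f (aS g x) = qext (fun y => qpt (aT g y)) (f x)) ->
  qG_hom aS aT (qext f).
Proof.
move=> fE; split=> [|r v]; first exact: qext_is_linear.
rewrite /qGscale linear_qext; apply: eq_qext => g.
by rewrite !linear_qext; apply: eq_qext => x; rewrite /= qext_pt fE.
Qed.

(** The field K may have positive characteristic: the point of the lemma is that
linear independence of the columns of an integral matrix can be tested after
reduction modulo a prime. *)
Lemma qext_surj_modp (K : fieldType) (S T : finType) (M : S -> T -> int) :
  (forall f : T -> K, (forall x, \sum_y (M x y)%:~R * f y = 0) ->
     forall y, f y = 0) ->
  forall v : qfree T, exists u : qfree S,
    qext (fun x => \sum_y (M x y)%:~R *: qpt y) u = v.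
Proof.
move=> inj v.
pose A : 'M[int]_(#|S|, #|T|) := \matrix_(i, j) M (enum_val i) (enum_val j).
have fullQ : row_full (map_mx intr A : 'M[rat]__).
  apply: (@row_full_intr K); apply: row_full_ker => c Ac.
  apply/colP=> j; rewrite mxE -(enum_valK j).
  apply: (inj (fun y => c (enum_rank y) 0)) => x.
  have /matrixP/(_ (enum_rank x) 0) := Ac; rewrite !mxE; apply: etrans.
  rewrite (reindex _ (onW_bij _ (enum_val_bij T))) /=; apply: eq_bigr => k _.
  by rewrite !mxE enum_rankK enum_valK.
pose r : 'rV[rat]_#|T| := \row_j v (enum_val j).
have /submxP[d dE] := submx_full r fullQ.
exists [ffun x => d 0 (enum_rank x)].
rewrite [RHS]qfree_sum_pt /qext.
under eq_bigr do rewrite scaler_sumr.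
rewrite exchange_big /=; apply: eq_bigr => y _.
under eq_bigr do rewrite scalerA.
rewrite -scaler_suml; congr (_ *: _).
have /matrixP/(_ 0 (enum_rank y)) := dE; rewrite !mxE enum_rankK => ->.
rewrite (reindex _ (onW_bij _ (enum_val_bij S))) /=; apply: eq_bigr => k _.
by rewrite !mxE ffunE enum_valK enum_rankK.
Qed.

(** * Sums of the values of a polynomial over a finite field *)

Section PowerSums.
Variable F : finFieldType.

(** A translation permutes F, so that the sum of (x + 1) - x vanishes. *)
Lemma sum_one : \sum_(x : F) 1 = 0 :> F.
Proof.
transitivity (\sum_(x : F) ((x + 1) - x)).
  by apply: eq_bigr => x _; rewrite addrC addKr.
apply/eqP; rewrite sumrB subr_eq0 eq_sym; apply/eqP.
exact: (reindex_inj (addIr 1)).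
Qed.

Lemma expf_pred_card_neq0 (x : F) : x != 0 -> x ^+ #|F|.-1 = 1.
Proof.
move=> x0; apply: (mulfI x0); rewrite -exprS mulr1 prednK ?expf_card //.
exact: ltnW (finNzRing_gt1 F).
Qed.

Lemma expf_pred_card (x : F) : x ^+ #|F|.-1 = 1 - (x == 0)%:R.
Proof.
have [->|x0] := eqVneq x 0; last by rewrite expf_pred_card_neq0 // subr0.
by rewrite expr0n -(subnKC (finNzRing_gt1 F)) subrr.
Qed.

(** The case x = 0 holds because the inverse of 0 is 0; it is the reason for
excluding the field with two elements. *)
Lemma invf_expr (x : F) : (2 < #|F|)%N -> x^-1 = x ^+ #|F|.-2.
Proof.
move=> F2; have [->|x0] := eqVneq x 0.
  by rewrite invr0 expr0n -(subnKC F2).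
apply: (mulfI x0); rewrite mulfV // -exprS -[LHS](expf_pred_card_neq0 x0).
by congr (_ ^+ _); lia.
Qed.

Lemma sum_exp_pred_card : \sum_(x : F) x ^+ #|F|.-1 = -1.
Proof.
under eq_bigr do rewrite expf_pred_card.
rewrite sumrB sum_one sub0r (bigD1 0) //= eqxx big1 ?addr0 // => x x0.
by rewrite (negPf x0).
Qed.

(** Since X^n - 1 has fewer than #|F| - 1 roots, some a <> 0 has a^n <> 1; the
substitution x -> a x multiplies the sum by a^n. *)
Lemma sum_exp_lt (n : nat) : (n < #|F|.-1)%N -> \sum_(x : F) x ^+ n = 0.
Proof.
case: n => [|n] nq; first by under eq_bigr do rewrite expr0; exact: sum_one.
have [a /andP[a0 an]] : exists a : F, (a != 0) && (a ^+ n.+1 != 1).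
  apply/existsP; apply: contraT; rewrite negb_exists => /forallP all1.
  have p0 : 'X^(n.+1) - 1 != 0 :> {poly F}.
    by rewrite -size_poly_eq0 size_XnsubC.
  have /(max_poly_roots p0) : all (root ('X^(n.+1) - 1)) (enum [pred x : F | x != 0]).
    apply/allP => x; rewrite mem_enum inE => x0; have := all1 x.
    by rewrite x0 /= negbK rootE !hornerE subr_eq0.
  rewrite enum_uniq -cardE size_XnsubC // => /(_ isT).
  have := cardC (pred1 (0 : F)); rewrite card1 => E.
  have -> : #|[pred x : F | x != 0]| = #|F|.-1 by rewrite -E.
  by rewrite ltnS leqNgt nq.
apply/eqP; rewrite -(mulrI_eq0 _ (mulfI _ : GRing.lreg (a ^+ n.+1 - 1))) ?subr_eq0 //.
rewrite mulrBl mul1r subr_eq0 mulr_sumr [eqbRHS](reindex_inj (mulfI a0)).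
by apply/eqP/eq_bigr => x _; rewrite exprMn.
Qed.

(** Among the exponents below 2 (#|F| - 1), only #|F| - 1 has a nonzero power
sum: 0 is a multiple of #|F| - 1 too, but the power sum then counts x = 0. *)
Lemma sum_horner (p : {poly F}) :
  (size p <= #|F|.-1.*2)%N -> \sum_(x : F) p.[x] = - p`_#|F|.-1.
Proof.
have F1 : (1 < #|F|)%N := finNzRing_gt1 F; move=> sp.
under eq_bigr => x _ do rewrite (horner_coef_wide x sp).
rewrite exchange_big /=.
have qlt : (#|F|.-1 < #|F|.-1.*2)%N by lia.
rewrite (bigD1 (Ordinal qlt)) //= -mulr_sumr sum_exp_pred_card mulrN1.
rewrite big1 ?addr0 // => i; rewrite -val_eqE /= => /eqP iq.
have {}iq : nat_of_ord i <> #|F|.-1 := iq.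
rewrite -mulr_sumr; suff -> : \sum_(x : F) x ^+ i = 0 by rewrite mulr0.
have [lt|ge] := ltnP i #|F|.-1; first exact: sum_exp_lt.
have il : (i < #|F|.-1.*2)%N := ltn_ord i.
have -> : nat_of_ord i = (#|F| + (i - #|F|))%N by lia.
under eq_bigr => x _ do rewrite exprD expf_card -exprS.
by apply: sum_exp_lt; lia.
Qed.

End PowerSums.

(** * The sums attached to the powers of the imaginary part *)

Lemma coef_expXsubC (R : comNzRingType) (c : R) (k i : nat) :
  (('X - c%:P) ^+ k)`_i = (- c) ^+ (k - i) *+ 'C(k, i).
Proof.
rewrite addrC -polyCN exprDn.
have -> : \sum_(j < k.+1) (- c)%:P ^+ (k - j) * 'X^j *+ 'C(k, j) =
    \poly_(j < k.+1) ((- c) ^+ (k - j) *+ 'C(k, j)).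
  rewrite poly_def; apply: eq_bigr => j _.
  by rewrite -polyC_exp mul_polyC scalerMnl.
by rewrite coef_poly ltnS; case: leqP => // /bin_small ->.
Qed.

Lemma coef_expX2subC (R : comNzRingType) (c : R) (k i : nat) :
  (('X^2 - c%:P) ^+ k)`_i =
    if (2 %| i)%N then (- c) ^+ (k - i %/ 2) *+ 'C(k, i %/ 2) else 0.
Proof.
have -> : ('X^2 - c%:P) ^+ k = (('X - c%:P) ^+ k) \Po 'X^2.
  by rewrite rmorphXn rmorphB /= comp_polyX comp_polyC.
by rewrite coef_comp_poly_Xn // coef_expXsubC.
Qed.

Section PrimeField.
Variables (l : nat) (l_prime : prime l).

Lemma natr_Fp_eq0 (n : nat) : (n%:R == 0 :> 'F_l) = (l %| n)%N.
Proof. by rewrite (dvdn_pcharf (pchar_Fp l_prime)). Qed.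

Lemma bin_Fp_neq0 (n i : nat) : (i <= n < l)%N -> 'C(n, i)%:R != 0 :> 'F_l.
Proof.
move=> /andP[le_in lt_nl]; rewrite natr_Fp_eq0; apply/negP => dvd_bin.
have : (l %| n`!)%N by rewrite -(bin_fact le_in) dvdn_mulr.
apply/negP; elim: n lt_nl {le_in dvd_bin} => [|n IHn] lt_nl.
  by rewrite dvdn1 neq_ltn prime_gt1 // orbT.
by rewrite factS Euclid_dvdM // negb_or IHn ?(ltnW lt_nl) // gtnNdvd.
Qed.

Lemma sum_nat_Fp (G : nat -> 'F_l) (H : 'F_l -> 'F_l) :
  (forall s, (1 <= s < l)%N -> G s = H s%:R) ->
  \sum_(1 <= s < l) G s = \sum_(s : 'F_l | s != 0) H s.
Proof.
move=> GH; have l1 := prime_gt1 l_prime.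
have iotaE : index_iota 0 l = index_iota 0 (Zp_trunc (pdiv l)).+2.
  by rewrite Fp_cast.
transitivity (\sum_(0 <= s < l | s%:R != 0 :> 'F_l) H s%:R).
  rewrite [RHS]big_mkcond [RHS]big_ltn ?prime_gt0 // eqxx /= add0r.
  rewrite big_nat [RHS]big_nat; apply: eq_bigr => s /[dup] sl /andP[s0 s1].
  by rewrite GH // natr_Fp_eq0 // gtnNdvd.
rewrite iotaE big_mkord.
by apply: eq_big => s /=; rewrite ?natr_Zp.
Qed.

Lemma sum_weight : odd l -> \sum_(s : 'F_l | s != 0) (1 + s^-1) = -1.
Proof.
move=> l_odd; have cF := card_Fp l_prime; have l1 := prime_gt1 l_prime.
have l2 : (2 < l)%N by lia.
have sum0 (G : 'F_l -> 'F_l) : \sum_(s | s != 0) G s = \sum_s G s - G 0.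
  by rewrite [in RHS](bigD1 0) //= addrC addrK.
rewrite sum0 big_split /= sum_one invr0 addr0 add0r.
under eq_bigr do rewrite invf_expr ?cF //.
by rewrite sum_exp_lt ?cF ?sub0r //; lia.
Qed.

(** The weight is the polynomial 1 + s^(l - 2), so that summing over s extracts
the coefficient of s^(l - 1), to which (s + v)^e contributes by its coefficient
of s; the other term compensates for s = 0. *)
Lemma sum_weight_powers (e : nat) (v : 'F_l) : (0 < e < l.-1)%N ->
  \sum_(s : 'F_l | s != 0) (1 + s^-1) * (s + v) ^+ e =
  - (v ^+ e + e%:R * v ^+ e.-1).
Proof.
move=> /andP[e0 el]; have cF := card_Fp l_prime.
have l1 := prime_gt1 l_prime.
pose Q : {poly 'F_l} := ('X - (- v)%:P) ^+ e.
have sQ : size Q = e.+1 by rewrite size_exp_XsubC.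
pose P : {poly 'F_l} := Q + 'X^(l.-2) * Q.
have PE s : P.[s] = (1 + s^-1) * (s + v) ^+ e.
  by rewrite /P /Q !hornerE opprK mulrDl mul1r invf_expr cF //; lia.
have : \sum_(s : 'F_l) P.[s] = - (e%:R * v ^+ e.-1).
  rewrite sum_horner cF.
    rewrite /P coefD coefXnM ltnNge leq_pred /=.
    have -> : (l.-1 - l.-2 = 1)%N by lia.
    rewrite nth_default ?sQ // add0r coef_expXsubC opprK bin1 subn1.
    by rewrite mulr_natl.
  apply: (leq_trans (size_polyD _ _)); rewrite geq_max sQ.
  rewrite (leq_trans (size_polyMleq _ _)) ?size_polyXn ?sQ //=; lia.
rewrite (bigD1 0) //= PE invr0 addr0 mul1r add0r opprD => <-.
by rewrite addrA addNr add0r; apply: eq_bigr => s _; rewrite PE.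
Qed.

(** With v = t - s and e = l - 1 - k, summing first over s and then over v gives
c_k + e c_(k+1), for c_i the coefficient of X^i in (X^2 - eps)^k.  Only one of
the two is nonzero, that of even index, and it is a binomial coefficient of k
times a power of - eps. *)
Lemma orbit_sum_neq0 (eps : 'F_l) (k : nat) : eps != 0 -> (0 < k < l.-1)%N ->
  \sum_(s : 'F_l | s != 0) (1 + s^-1) *
    \sum_(t : 'F_l | t != 0) t ^+ (l.-1 - k) * ((t - s) ^+ 2 - eps) ^+ k != 0.
Proof.
move=> eps0 /andP[k0 kl]; set e := (l.-1 - k)%N.
have cF := card_Fp l_prime; have l1 := prime_gt1 l_prime.
have eb : (0 < e < l.-1)%N by rewrite /e; lia.
pose Z : {poly 'F_l} := ('X^2 - eps%:P) ^+ k.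
have -> : \sum_(s : 'F_l | s != 0) (1 + s^-1) *
    \sum_(t : 'F_l | t != 0) t ^+ e * ((t - s) ^+ 2 - eps) ^+ k =
    - \sum_(v : 'F_l) (Z * ('X^e + e%:R *: 'X^(e.-1))).[v].
  transitivity (\sum_(s : 'F_l | s != 0) \sum_(v : 'F_l)
      (v ^+ 2 - eps) ^+ k * ((1 + s^-1) * (s + v) ^+ e)).
    apply: eq_bigr => s _; rewrite big_mkcond /= mulr_sumr (reindex_inj (addrI s)).
    apply: eq_bigr => v _; rewrite (_ : s + v - s = v); last by ring.
    (* the term t = s + v = 0 may be added because e > 0 *)
    case: eqP => [->|_] /=; last by ring.
    by rewrite expr0n -[_ == _]/(e == 0)%N gtn_eqF ?mulr0 //; case/andP: eb.
  rewrite exchange_big -sumrN; apply: eq_bigr => v _.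
  rewrite -mulr_sumr sum_weight_powers // mulrN /Z.
  by rewrite !hornerE.
rewrite sum_horner cF ?opprK.
  have -> : (Z * ('X^e + e%:R *: 'X^(e.-1)))`_l.-1 = Z`_k + e%:R * Z`_k.+1.
    rewrite mulrDr -scalerAr coefD coefZ !coefMXn !ifN -?leqNgt; try lia.
    by congr (Z`_ _ + _ * Z`_ _); rewrite /e; lia.
  have nz i : (i <= k)%N -> (- eps) ^+ (k - i) *+ 'C(k, i) != 0.
    move=> ik; rewrite -mulr_natl mulf_neq0 ?expf_neq0 ?oppr_eq0 //.
    by apply: bin_Fp_neq0; lia.
  rewrite !coef_expX2subC; case: ifP => k2.
    rewrite ifF ?mulr0 ?addr0 ?nz //; lia.
  rewrite ifT ?add0r; last by lia.
  rewrite mulf_neq0 ?nz //; last by lia.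
  by rewrite natr_Fp_eq0 gtnNdvd //; lia.
apply: (leq_trans (size_polyMleq _ _)).
have : (size Z <= k.*2.+1)%N.
  apply: leq_trans (size_poly_exp_leq _ _) _.
  by rewrite size_XnsubC //; lia.
have : (size ('X^e + e%:R *: 'X^(e.-1) : {poly 'F_l})%R <= e.+1)%N.
  apply: (leq_trans (size_polyD _ _)); rewrite geq_max size_polyXn leqnn /=.
  by apply: leq_trans (size_scale_leq _ _) _; rewrite size_polyXn; lia.
move=> sW sZ; rewrite -subn1 leq_subLR; apply: leq_trans (leq_add sZ sW) _.
by rewrite /e; lia.
Qed.

End PrimeField.

(** * Moments of a function on the upper half plane *)

Section Moments.
Variables (F : finFieldType) (phi : F -> F -> F).

Definition moment (j k : nat) : F :=
  \sum_(x : F) \sum_(y : F | y != 0) x ^+ j * y ^+ k * phi x y.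

Lemma moment_poly (p q : {poly F}) : (forall j k, moment j k = 0) ->
  \sum_(x : F) \sum_(y : F | y != 0) p.[x] * q.[y] * phi x y = 0.
Proof.
move=> mom0.
transitivity (\sum_(i < size p) \sum_(j < size q) p`_i * q`_j * moment i j).
  under [RHS]eq_bigr do under eq_bigr do rewrite mulr_sumr.
  under [RHS]eq_bigr do rewrite exchange_big.
  rewrite [RHS]exchange_big; apply: eq_bigr => x _.
  under [RHS]eq_bigr do under eq_bigr do rewrite mulr_sumr.
  under [RHS]eq_bigr do rewrite exchange_big.
  rewrite [RHS]exchange_big; apply: eq_bigr => y _ /=.
  rewrite !horner_coef big_distrlr /= mulr_suml; apply: eq_bigr => i _.
  by rewrite mulr_suml; apply: eq_bigr => j _; ring.
by apply: big1 => i _; apply: big1 => j _; rewrite mom0 mulr0.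
Qed.

(** Every function on a finite field is a polynomial, in particular the
indicator function 1 - (x - c)^(#|F| - 1) of a point c. *)
Lemma moments_eq0 : (forall j k, moment j k = 0) ->
  forall a b, b != 0 -> phi a b = 0.
Proof.
move=> mom0 a b b0.
pose ind (c : F) : {poly F} := 1 - ('X - c%:P) ^+ #|F|.-1.
have indE c x : (ind c).[x] = (x == c)%:R.
  by rewrite /ind !hornerE expf_pred_card subr_eq0; ring.
have := moment_poly (ind a) (ind b) mom0.
rewrite (bigD1 a) //= [X in _ + X]big1 => [|x xa]; last first.
  by apply: big1 => y _; rewrite indE (negPf xa) !mul0r.
rewrite (bigD1 b) //= big1 => [|y /andP[_ yb]]; last first.
  by rewrite (indE b y) (negPf yb) mulr0 mul0r.
by rewrite !indE !eqxx !mul1r !addr0.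
Qed.

(** In the coordinates X = m x + t and Y = m y of the translated point, m is
Y / y and t is X - Y x / y.  The expansion of t^j involves the moments of order
at most j in X, of which only X^j survives, so that x disappears. *)
Lemma moment_translates (j k : nat) (x y : F) : y != 0 ->
  (forall i, (i < j)%N -> forall k', moment i k' = 0) ->
  \sum_(m : F | m != 0) \sum_(t : F) m ^+ k * t ^+ j * phi (m * x + t) (m * y) =
  moment j k / y ^+ k.
Proof.
move=> y0 mom0; pose c := x / y.
transitivity (\sum_(Y : F | Y != 0) \sum_(X : F)
    (Y / y) ^+ k * (X - Y * c) ^+ j * phi X Y).
  rewrite [RHS](reindex_inj (mulIf y0)) /=.
  under [RHS]eq_bigl do rewrite mulf_eq0 (negPf y0) orbF.
  apply: eq_bigr => m _; rewrite mulfK // [RHS](reindex_inj (addrI (m * x))) /=.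
  apply: eq_bigr => t _; congr (_ * _ ^+ _ * _).
  by rewrite /c; field.
transitivity (\sum_(i < j.+1)
    (-1) ^+ i * c ^+ i / y ^+ k *+ 'C(j, i) * moment (j - i) (k + i)).
  under [RHS]eq_bigr do rewrite mulr_sumr.
  rewrite [RHS]exchange_big [LHS]exchange_big; apply: eq_bigr => X _ /=.
  under [RHS]eq_bigr do rewrite mulr_sumr.
  rewrite [RHS]exchange_big; apply: eq_bigr => y1 _ /=.
  rewrite exprBn mulr_sumr mulr_suml; apply: eq_bigr => i _.
  rewrite !(mulrnAl, mulrnAr) exprD !exprMn exprVn; congr (_ *+ _).
  move: ((-1) ^+ i) (_ ^- k) (X ^+ _) (y1 ^+ k) (y1 ^+ i) (c ^+ i) => *.
  ring.
rewrite big_ord_recl big1 => [|i _]; last first.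
  by rewrite mom0 ?mulr0 // lift0; have := ltn_ord i; lia.
by rewrite bin0 subn0 addn0 !expr0 !mulr1 mul1r mulr1n addr0 mulrC.
Qed.

End Moments.

(** * Relations between the columns of the matrix of psi modulo l *)

Section Relations.
Variables (l : nat) (l_prime : prime l) (l_odd : odd l).
Variables (eps : 'F_l) (eps0 : eps != 0) (nsq : forall t : 'F_l, t ^+ 2 != eps).

(** The point z = lam (s + w) of the path from 0 to oo is sent by the matrix
(1 0; r 1) to z / (r z + 1) = path_re + path_im w, and path_den is the norm of
r z + 1; the paths from 0 to oo and from 0 to 1/r are covered by r = 0 and by
r <> 0. *)
Definition path_den (r s lam : 'F_l) :=
  (r * (lam * s) + 1) ^+ 2 - eps * (r * lam) ^+ 2.
Definition path_re (r s lam : 'F_l) :=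
  (lam * s * (r * (lam * s) + 1) - eps * r * lam ^+ 2) / path_den r s lam.
Definition path_im (r s lam : 'F_l) := lam / path_den r s lam.

Lemma path_den_neq0 r s lam : lam != 0 -> path_den r s lam != 0.
Proof. by move=> lam0; apply: norm_den_neq0 => //; rewrite oner_neq0 orbT. Qed.

Lemma path_im_neq0 r s lam : lam != 0 -> path_im r s lam != 0.
Proof. by move=> lam0; rewrite mulf_neq0 // invr_neq0 // path_den_neq0. Qed.

(** No power of the imaginary part satisfies all the relations: r = 0 refutes
the exponents divisible by l - 1, and r = - 1 the others, for which the sum
becomes that of [orbit_sum_neq0] after lam is replaced with 1 / t. *)
Lemma im_sum_neq0 (k : nat) : exists r : 'F_l,
  \sum_(s : 'F_l | s != 0) (1 + s^-1) *
    \sum_(lam : 'F_l | lam != 0) (path_im r s lam ^+ k)^-1 != 0.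
Proof.
have cF := card_Fp l_prime; have l1 := prime_gt1 l_prime.
pose k' := (k %% l.-1)%N.
have k'l : (k' < l.-1)%N by rewrite ltn_mod; lia.
have fermat (y : 'F_l) : y != 0 -> y ^+ l.-1 = 1.
  by move=> y0; rewrite -[RHS](expf_pred_card_neq0 y0) cF.
have powE (y : 'F_l) : y != 0 -> y ^+ k = y ^+ k'.
  move=> y0; rewrite {1}(divn_eq k l.-1) exprD mulnC exprM fermat //.
  by rewrite expr1n mul1r.
have [k0|k0] := posnP k'.
  exists 0; under eq_bigr => s _.
    under eq_bigr => lam lam0 do rewrite powE ?path_im_neq0 // k0 expr0 invr1.
    over.
  rewrite /= -mulr_suml sum_weight //.
  have := sum_one 'F_l; rewrite (bigD1 0) //= => /eqP.
  by rewrite addrC addr_eq0 => /eqP ->; rewrite mulrNN mulr1 oner_neq0.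
exists (-1).
have <- : \sum_(s : 'F_l | s != 0) (1 + s^-1) *
    \sum_(t : 'F_l | t != 0) t ^+ (l.-1 - k') * ((t - s) ^+ 2 - eps) ^+ k' =
  \sum_(s : 'F_l | s != 0) (1 + s^-1) *
    \sum_(lam : 'F_l | lam != 0) (path_im (-1) s lam ^+ k)^-1.
  apply: eq_bigr => s _; congr (_ * _).
  rewrite [RHS](reindex_inj invr_inj) /=.
  under [RHS]eq_bigl do rewrite invr_eq0.
  apply: eq_bigr => t t0; have tV0 : t^-1 != 0 by rewrite invr_eq0.
  rewrite powE ?path_im_neq0 // -exprVn.
  have -> : (path_im (-1) s t^-1)^-1 = ((t - s) ^+ 2 - eps) / t.
    by rewrite /path_im /path_den invf_div; field; rewrite t0 oner_neq0.
  have -> : t ^+ (l.-1 - k') = (t ^+ k')^-1.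
    apply: (mulIf (expf_neq0 k' t0)); rewrite mulVf ?expf_neq0 // -exprD.
    by rewrite subnK ?(ltnW k'l) // fermat.
  by rewrite mulrC exprMn exprVn.
by apply: orbit_sum_neq0; rewrite ?k0.
Qed.

(** All moments of phi vanish, by induction on the exponent j of x: once the
moments of lower order vanish, the combination of the relations with
coefficients m^k t^j is the moment of order (j, k) times a nonzero number. *)
Lemma kernel_trivial (phi : 'F_l -> 'F_l -> 'F_l) :
  (forall m t r, m != 0 ->
    \sum_(s : 'F_l | s != 0) (1 + s^-1) * \sum_(lam : 'F_l | lam != 0)
      phi (m * path_re r s lam + t) (m * path_im r s lam) = 0) ->
  forall a b, b != 0 -> phi a b = 0.
Proof.
move=> rel; apply: moments_eq0 => j; elim/ltn_ind: j => j IHj k.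
have [r nz] := im_sum_neq0 k; apply: (mulIf nz); rewrite mul0r.
transitivity (\sum_(m : 'F_l | m != 0) \sum_(t : 'F_l) m ^+ k * t ^+ j *
  \sum_(s : 'F_l | s != 0) (1 + s^-1) * \sum_(lam : 'F_l | lam != 0)
    phi (m * path_re r s lam + t) (m * path_im r s lam)).
  rewrite mulr_sumr.
  under [RHS]eq_bigr do under eq_bigr do rewrite mulr_sumr.
  under [RHS]eq_bigr do rewrite exchange_big.
  rewrite [RHS]exchange_big; apply: eq_bigr => s _ /=.
  rewrite mulrCA !mulr_sumr.
  under [RHS]eq_bigr do under eq_bigr do rewrite mulrCA !mulr_sumr.
  under [RHS]eq_bigr do rewrite exchange_big.
  rewrite [RHS]exchange_big; apply: eq_bigr => lam lam0 /=.
  rewrite -(moment_translates k (path_re r s lam) (path_im_neq0 r s lam0) IHj).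
  by rewrite mulr_sumr; apply: eq_bigr => m _; rewrite mulr_sumr.
by apply: big1 => m m0; apply: big1 => t _; rewrite rel ?mulr0.
Qed.

End Relations.

(** * Paths in the upper half plane *)

Lemma GL2_of_entries (F : finFieldType) (p q r u : F) : p * u - q * r != 0 ->
  exists g : {'GL_2[F]}, [/\ GLval g 0 0 = p, GLval g 0 1 = q,
    GLval g 1 0 = r & GLval g 1 1 = u].
Proof.
move=> D0.
pose M : 'M[F]_2 := \matrix_(i, j)
  if i == 0 then (if j == 0 then p else q) else (if j == 0 then r else u).
have MU : M \is a GRing.unit.
  rewrite -[_ \is a _]/(M \in unitmx) unitmxE unitfE.
  rewrite (expand_det_row _ 0) sum2E /cofactor !det_mx11 !mxE /=.
  by rewrite expr0 expr1 mul1r mulN1r mulrN.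
by exists (Sub M MU : {'GL_2[F]}); rewrite [GLval _]SubK !mxE.
Qed.

Section Paths.
Variables (F L : finFieldType) (iota : {rmorphism F -> L}) (eps : F) (w : L).
Variables (nsq : forall t : F, t ^+ 2 != eps) (w_sqr : w ^+ 2 = iota eps).

Lemma Cact_inj (g : {'GL_2[F]}) : injective (@Cact F L iota w g).
Proof.
have [a1 aM] := Cact_laction nsq w_sqr.
by apply: (can_inj (g := @Cact F L iota w g^-1%g)) => z; rewrite -aM mulVg a1.
Qed.

Lemma gamma_act (g : {'GL_2[F]}) (s : F) (ab : P1pair F) :
  gamma iota w s (P1pair_act g ab) = [set Cact g z | z in gamma iota w s ab].
Proof.
have [_ PM] := P1act_laction F; have [_ CM] := Cact_laction nsq w_sqr.
have [h [h0 hoo]] := gamma_exists ab.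
rewrite (gammaE s nsq w_sqr h0 hoo) -imset_comp.
rewrite (@gammaE _ _ _ _ _ s _ (g * h)%g nsq w_sqr) ?PM ?h0 ?hoo //.
by apply: eq_imset => z; rewrite /= CM.
Qed.

(** The parameter lam of a path is determined by the point because w is not in
the image of F, eps being a non-square. *)
Lemma sum_gamma0oo (s : F) (V : nmodType) (G : L -> V) :
  \sum_(z in gamma0oo iota w s) G (val z) =
  \sum_(lam : F | lam != 0) G (iota (lam * s) + iota lam * w).
Proof.
pose e (lam : F) : L := iota (lam * s) + iota lam * w.
have eC lam : lam != 0 -> e lam \in Cset iota w.
  by move=> lam0; apply/imsetP; exists (lam * s, lam); rewrite ?inE.
have e_inj : injective e.
  move=> a b /eqP; rewrite /e -subr_eq0.
  have -> : iota (a * s) + iota a * w - (iota (b * s) + iota b * w) =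
      iota (a - b) * (iota s + w) by rewrite !(rmorphM, rmorphB) /=; ring.
  rewrite mulf_eq0 fmorph_eq0 subr_eq0 => /orP[/eqP //|].
  rewrite addrC addr_eq0 => /eqP wE; have := nsq s.
  by rewrite -(inj_eq (fmorph_inj iota)) -w_sqr wE sqrrN rmorphXn eqxx.
pose z0 : Cl iota w := Sub (e 1) (eC 1 (oner_neq0 F)).
pose ez lam := insubd z0 (e lam).
have ezE lam : lam != 0 -> val (ez lam) = e lam.
  by move=> lam0; rewrite val_insubd eC.
have -> : gamma0oo iota w s = [set ez lam | lam in [pred lam | lam != 0]].
  apply/setP => z; rewrite inE; apply/existsP/imsetP => -[lam].
    by case/andP=> lam0 /eqP zE; exists lam => //; apply: val_inj; rewrite ezE.
  by rewrite inE => lam0 ->; exists lam; rewrite lam0 ezE /=.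
rewrite big_imset /=; first by apply: eq_bigr => lam lam0; rewrite ezE.
by move=> a b a0 b0 /(congr1 val); rewrite !ezE // => /e_inj.
Qed.

End Paths.

(** The matrix of g is (m t; 0 1) (1 0; r 1). *)
Lemma flt_path (l : nat) (eps : 'F_l) (L : finFieldType) (iota : {rmorphism 'F_l -> L})
    (w : L) (g : {'GL_2['F_l]}) (m t r s lam : 'F_l) :
  (forall t : 'F_l, t ^+ 2 != eps) -> w ^+ 2 = iota eps -> lam != 0 ->
  GLval g 0 0 = m + t * r -> GLval g 0 1 = t ->
  GLval g 1 0 = r -> GLval g 1 1 = 1 ->
  flt (map_mx iota g) (iota (lam * s) + iota lam * w) =
  iota (m * path_re eps r s lam + t) + iota (m * path_im eps r s lam) * w.
Proof.
move=> nsq wE lam0 g00 g01 g10 g11; rewrite /flt !mxE g00 g01 g10 g11.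
have cd : (r != 0) || (1 != 0 :> 'F_l) by rewrite oner_neq0 orbT.
have D0 := Cl_den_neq0 (lam * s) nsq wE lam0 cd.
have N0 := path_den_neq0 nsq r s lam0.
rewrite -(fmorph_eq0 iota) in N0; move: D0 N0; rewrite /path_re /path_im /path_den.
rewrite !(rmorphD, rmorphN, rmorphXn, rmorphM, fmorphV, rmorph1) /= -wE => D0 N0.
by field; rewrite exprMn N0 D0.
Qed.

Lemma psi_hom (l : nat) (eps : 'F_l) (L : finFieldType)
    (iota : {rmorphism 'F_l -> L}) (w : L) (c : nat -> rat) :
  (forall t : 'F_l, t ^+ 2 != eps) -> w ^+ 2 = iota eps ->
  qG_hom (@P1pair_act 'F_l) (@Cact 'F_l L iota w) (psi iota w c).
Proof.
move=> nsq wE; apply: qext_hom => g ab.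
rewrite linear_sum; apply: eq_bigr => s _; rewrite linearZ; congr (_ *: _).
rewrite (gamma_act nsq wE) big_imset /=.
  by rewrite linear_sum; apply: eq_bigr => z _; rewrite /= qext_pt.
by move=> z z' _ _; apply: (Cact_inj nsq wE).
Qed.

Unset Implicit Arguments.
Set Strict Implicit.

Theorem theorem2
  (l : nat) (l_prime : prime l) (l_odd : odd l)
  (eps : 'F_l) (eps_neq0 : eps != 0) (eps_nonsquare : forall t : 'F_l, t ^+ 2 != eps)
  (* L is a field with l ^ 2 elements and w is a square root of eps in it *)
  (L : finFieldType) (cardL : #|L| = (l ^ 2)%N)
  (iota : {rmorphism 'F_l -> L}) (w : L) (w_sqr : w ^+ 2 = iota eps)
  (alpha beta : nat -> nat)
  (alpha_bound : forall s : nat, (1 <= s <= l - 1)%N -> (alpha s <= l - 1)%N)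
  (alpha_mod : forall s : nat, (1 <= s <= l - 1)%N -> (alpha s)%:R = 1 :> 'F_l)
  (beta_bound : forall s : nat, (1 <= s <= l - 1)%N -> (beta s <= l - 1)%N)
  (beta_mod : forall s : nat, (1 <= s <= l - 1)%N -> (beta s)%:R = (s%:R)^-1 :> 'F_l) :
  qG_hom (@P1pair_act 'F_l) (@Cact 'F_l L iota w)
         (psi iota w (fun s => (alpha s + beta s)%:R)) /\
  (forall v : qfree (Cl iota w), exists u : qfree (P1pair 'F_l),
     psi iota w (fun s => (alpha s + beta s)%:R) u = v).
Proof.
have [nsq wE] := (eps_nonsquare, w_sqr).
split; first exact: psi_hom.
pose M (ab : P1pair 'F_l) (z : Cl iota w) : int :=
  (\sum_(1 <= s < l) (alpha s + beta s) * (z \in gamma iota w s%:R ab))%N.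
have ME (R : pzRingType) ab z : (M ab z)%:~R =
    \sum_(1 <= s < l) (alpha s + beta s)%:R * (z \in gamma iota w s%:R ab)%:R :> R.
  by rewrite /M -pmulrn natr_sum; apply: eq_bigr => s _; rewrite natrM.
have psiE u : psi iota w (fun s => (alpha s + beta s)%:R) u =
    qext (fun ab => \sum_z (M ab z)%:~R *: qpt z) u.
  apply: eq_qext => ab.
  under [RHS]eq_bigr do rewrite ME scaler_suml.
  rewrite exchange_big /=; apply: eq_bigr => s _.
  rewrite big_mkcond scaler_sumr; apply: eq_bigr => z _.
  by case: ifP => _; rewrite ?mulr1 // mulr0 scale0r scaler0.
suff inj (f : Cl iota w -> 'F_l) :
    (forall ab, \sum_z (M ab z)%:~R * f z = 0) -> forall z, f z = 0.
  move=> v; have [u uE] := qext_surj_modp inj v.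
  by exists u; rewrite psiE.
move=> fker.
(* f is extended by zero, so that it can be evaluated on coordinates *)
pose ext (u : L) : 'F_l := if insub u is Some z then f z else 0.
have extE z : ext (val z) = f z by rewrite /ext valK.
(* the relation given by the pair g (0, oo) *)
have rel (g : {'GL_2['F_l]}) : \sum_(s : 'F_l | s != 0) (1 + s^-1) *
    \sum_(lam : 'F_l | lam != 0)
      ext (flt (map_mx iota g) (iota (lam * s) + iota lam * w)) = 0.
  pose o : P1pair 'F_l := exist _ (Some 0, None) isT.
  rewrite -[RHS](fker (P1pair_act g o)).
  under [RHS]eq_bigr do rewrite ME mulr_suml.
  rewrite [RHS]exchange_big /=; apply/esym/sum_nat_Fp => // s sl.
  have {}sl : (1 <= s <= l - 1)%N by lia.
  have -> : 1 + s%:R^-1 = (alpha s + beta s)%:R :> 'F_l.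
    by rewrite natrD alpha_mod // beta_mod.
  under eq_bigr do rewrite -mulrA.
  rewrite -mulr_sumr; congr (_ * _).
  rewrite -(sum_gamma0oo nsq wE _ (fun u => ext (flt (map_mx iota g) u))).
  rewrite (@gammaE _ _ _ _ _ _ (P1pair_act g o) g nsq wE) //.
  transitivity (\sum_(z in [set Cact g z | z in gamma0oo iota w s%:R]) f z).
    rewrite [RHS]big_mkcond; apply: eq_bigr => z _.
    by case: ifP; rewrite ?mul1r ?mul0r.
  rewrite big_imset /=; last by move=> z z' _ _; apply: (Cact_inj nsq wE).
  by apply: eq_bigr => z _; rewrite -(val_Cact g z nsq wE) extE.
move=> z; case/imsetP: (valP z) => -[a b]; rewrite inE /= => b0 zE.
rewrite -extE [val z]zE.
apply: (kernel_trivial l_prime l_odd eps_neq0 nsq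
  (phi := fun x y => ext (iota x + iota y * w))) => // m t r m0.
have [g [g00 g01 g10 g11]] : exists g : {'GL_2['F_l]}, [/\ GLval g 0 0 = m + t * r,
    GLval g 0 1 = t, GLval g 1 0 = r & GLval g 1 1 = 1].
  by apply: GL2_of_entries; rewrite mulr1 addrK.
rewrite -[RHS](rel g); apply: eq_bigr => s _; congr (_ * _).
by apply: eq_bigr => lam lam0; rewrite (flt_path (m := m) (t := t) (r := r) s nsq wE lam0).
Qed.
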